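(* Let $d\ge 1$ and $1\le j\le d$ be integers. The function $\rho_{d,j}:\mathbb{R}^d\to\mathbb{R}$, $P\mapsto \rho_{d,j}(P)$, is an integral continuous function on $\mathbb{R}^d$ defined over $\mathbb{Q}$, and $P^{*}(\rho_{d,j}(P))=0$ for every monic real polynomial $P$ of degree $d$. Moreover, for every monic real polynomial $P$ of degree $d$, every real root of $P$ is equal to $\rho_{d,j}(P)$ for some $j\in\{1,\dots,d\}$.
   Context: For $d\ge 1$ the set of monic real polynomials $P=x^d-(a_{d-1}x^{d-1}+\dots+a_0)$ of degree $d$ is identified with $\mathbb{R}^d$ via $(a_{d-1},\dots,a_0)$. Function $\mathcal{R}_d$. For reals $a\le b$ and $P$ monic of degree $d\geq 1$ with $P'(x)P'(y)\ge 0$ for all $x,y\in[a,b]$, $\mathcal{R}_d(a,b,P)$ denotes the (unique) $z\in[a,b]$ such that $|P(z)|=\min\{|P(u)|:u\in[a,b]\}$. Put $m(P)=1+\max_{0\le i\le d-1}|a_i|$. If $P'\ge 0$ on $[a,+\infty)$, then $\mathcal{R}_d(a,+\infty,P)=\mathcal{R}_d(a,\max(a,m(P)),P)$. If $(-1)^{d-1}P'\ge 0$ on $(-\infty,b]$, then $\mathcal{R}_d(-\infty,b,P)=\mathcal{R}_d(\min(b,-m(P)),b,P)$. Virtual roots. For $d\ge 0$ and any integer $j$: $\rho_{d,j}(P)=-\infty$ if $j\le 0$; $\rho_{d,j}(P)=+\infty$ if $j>d$; $\rho_{1,1}(x-a)=a$; and for $d\ge 2$, $1\le j\le d$, inductively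 $\rho_{d,j}(P)=\mathcal{R}_d(\rho_{d-1,j-1}(P'/d),\rho_{d-1,j}(P'/d),P)$ (the arguments always lie in the domain of definition of $\mathcal{R}_d$). $P^{[i]}$ is the $(d-i)$-th derivative of $P$ divided by its leading coefficient (the normalized derivative of degree $i$), and $P^{*}$ is the product of all the normalized derivatives $P^{[i]}$, $P=P^{[d]}$ included. An integral continuous function on $\mathbb{R}^d$ defined over $\mathbb{Q}$ is a continuous function $\mathbb{R}^d\to\mathbb{R}$ which is $\mathbb{Q}$-semialgebraic (its graph is defined by a Boolean combination of polynomial equations and inequalities with rational coefficients) and which is integral over the polynomial ring $\mathbb{Q}[a_0,\dots,a_{d-1}]$ (it is annihilated by a monic polynomial in one variable with coefficients in this ring, viewed as functions on $\mathbb{R}^d$). *)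

(* Defs.v *)
From HB Require Import structures.
From mathcomp Require Import all_boot all_order all_algebra.
From mathcomp Require Import all_classical all_reals all_analysis.
From mathcomp Require mpoly.
(* The notations of mpoly clash with those of the analysis library, hence the
   unabbreviated [mpoly.mpoly n rat] for the ring Q[x_0, ..., x_(n-1)]. *)
Import -(notations) mpoly.

Set Implicit Arguments.
Unset Strict Implicit.
Unset Printing Implicit Defensive.

Import Order.TTheory GRing.Theory Num.Theory.
Import numFieldNormedType.Exports.

Local Open Scope classical_set_scope.
Local Open Scope ring_scope.

(* R^d is identified with the monic polynomials of degree d through the
   coordinates (a_(d-1), ..., a_0), so that a_i is the coordinate of index
   d - 1 - i. *)
Definition monic_of_coefs (R : realType) (d : nat) (v : 'rV[R]_d) : {poly R} :=
  'X^d - \sum_(i < d) (v ord0 (rev_ord i)) *: 'X^i.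

(* The function R_d on real arguments. The set below has exactly one element
   when (a, b, P) is in the domain of R_d, with P monic of degree d >= 1, and is
   empty outside of that domain; the value is then 0. *)
Definition absmin_set (R : realType) (a b : R) (P : {poly R}) : set R :=
  [set z : R |
    [/\ a <= b,
        (forall x y : R, a <= x <= b -> a <= y <= b ->
           0 <= P^`().[x] * P^`().[y]),
        a <= z <= b &
        forall u : R, a <= u <= b -> `|P.[z]| <= `|P.[u]|] ].

Definition absmin_fin (R : realType) (a b : R) (P : {poly R}) : R :=
  xget 0 (absmin_set a b P).

(* As P = X^d - (a_(d-1) X^(d-1) + ... + a_0), a_i is - P`_i. *)
Definition root_bound (R : realType) (d : nat) (P : {poly R}) : R :=
  1 + \big[Num.max/0]_(i < d) `|P`_i|.

Definition absmin (R : realType) (d : nat) (a b : \bar R) (P : {poly R}) : R :=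
  match a, b with
  | EFin a, EFin b => absmin_fin a b P
  | EFin a, +oo%E =>
      if `[< forall x : R, a <= x -> 0 <= P^`().[x] >]
      then absmin_fin a (Num.max a (root_bound d P)) P else 0
  | -oo%E, EFin b =>
      if `[< forall x : R, x <= b -> 0 <= (-1) ^+ d.-1 * P^`().[x] >]
      then absmin_fin (Num.min b (- root_bound d P)) b P else 0
  | _, _ => 0
  end.

(* rho_(d,j)(P), meaningful for P monic of degree d. In the innermost [match]
   one has 1 <= j <= d, so that the value given there for d = 0 is never used. *)
Fixpoint vroot (R : realType) (d : nat) (j : int) (P : {poly R}) : \bar R :=
  if j <= 0 then -oo%E
  else if d%:Z < j then +oo%E
  else match d with
       | 0 => +oo%E
       | d'.+1 =>
           if d' == 0%N then (- P`_0)%:E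
           else let Q := d%:R^-1 *: P^`() in
                (absmin d (vroot d' (j - 1) Q) (vroot d' j Q) P)%:E
       end.

(* The normalized derivative of degree i of P of degree d, for i <= d. *)
Definition normalized_deriv (R : realType) (d i : nat) (P : {poly R}) :
    {poly R} :=
  (lead_coef (P^`(d - i)))^-1 *: P^`(d - i).

Definition pstar (R : realType) (d : nat) (P : {poly R}) : {poly R} :=
  \prod_(i < d.+1) normalized_deriv d i P.

Definition evalQ (R : realType) (n : nat) (v : 'rV[R]_n)
    (p : mpoly.mpoly n rat) : R :=
  mpoly.meval (fun i => v ord0 i) (mpoly.map_mpoly (ratr : rat -> R) p).

Inductive Qformula (n : nat) : Type :=
| QEq of mpoly.mpoly n rat
| QPos of mpoly.mpoly n rat
| QNot of Qformula n
| QAnd of Qformula n & Qformula n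
| QOr of Qformula n & Qformula n.

Fixpoint Qholds (R : realType) (n : nat) (v : 'rV[R]_n) (phi : Qformula n) :
    Prop :=
  match phi with
  | QEq p => evalQ v p = 0
  | QPos p => 0 < evalQ v p
  | QNot f => ~ Qholds v f
  | QAnd f g => Qholds v f /\ Qholds v g
  | QOr f g => Qholds v f \/ Qholds v g
  end.

Definition Qsemialgebraic_set (R : realType) (n : nat) (S : set 'rV[R]_n) :
    Prop :=
  exists phi : Qformula n, S = [set w | Qholds w phi].

Definition graph_set (R : realType) (n : nat) (f : 'rV[R]_n -> R) :
    set 'rV[R]_(n + 1) :=
  [set row_mx v (f v)%:M | v in [set: 'rV[R]_n]].

Definition Qsemialgebraic_fun (R : realType) (n : nat) (f : 'rV[R]_n -> R) :
    Prop :=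
  Qsemialgebraic_set (graph_set f).

Definition integral_over_Qpoly (R : realType) (n : nat) (f : 'rV[R]_n -> R) :
    Prop :=
  exists2 q : {poly (mpoly.mpoly n rat)}, q \is monic &
    forall v : 'rV[R]_n, (map_poly (evalQ v) q).[f v] = 0.

Definition integral_continuous_over_Q (R : realType) (n : nat)
    (f : 'rV[R]_n -> R) : Prop :=
  [/\ continuous f, Qsemialgebraic_fun f & integral_over_Qpoly f].

(* Main.v *)
Require Import Defs.
From HB Require Import structures.
From mathcomp Require Import all_boot all_order all_algebra.
From mathcomp Require Import all_classical all_reals all_analysis.
From mathcomp Require mpoly.
From mathcomp Require Import polyrcf lra zify.
Import -(notations) mpoly.
Import Order.TTheory GRing.Theory Num.Theory.
Import numFieldNormedType.Exports.
Local Open Scope ring_scope.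

(** The definition of the virtual roots by minimization is replaced by a sign
condition. When sP is nondecreasing on [lo, hi], with s = 1 or s = -1, P being
monic and not constant, sP is strictly increasing there, so that the minimizer
of |P| is the only z in [lo, hi] at which sP passes from negative to positive
values, z being an end of the interval when sP has a constant sign; this is
what [crossing] says. It makes sense for infinite ends too, and the truncation
of the half-lines at m(P) gives the same point, because P has the sign of its
leading term beyond m(P).

Let Q = P'/(d+1), for P of degree d+1. By induction on the degree,
(-1)^(d-j) Q is positive strictly between the j-th and the (j+1)-st virtual
roots of Q ([vroot_signsP]). Hence the (j+1)-st virtual root of P is the
crossing of (-1)^(d-j) P between these two ([vroot_crossing]), and everything
is read off from this fact.

- A real root x of P lies between two consecutive virtual roots of Q, where it
  satisfies the definition of the crossing; the latter is unique
  ([vroot_root]).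
- A crossing is a zero of P or an end of the interval, that is a virtual root
  of Q, so P* vanishes there by induction ([pstar_vroot]). The coefficients of
  P* are rational polynomials in those of P and P* is monic, whence the
  integrality ([pstar_integral]).
- A crossing z on [lo, hi] of a function f satisfies: z < c if and only if
  lo < c and (f(c) > 0 or hi < c), and symmetrically for c < z. By induction,
  the relations rho(P) < c and c < rho(P) are therefore defined by formulas in
  the coefficients of P and in c which use only strict inequalities,
  conjunctions and disjunctions ([vroot_lt_formula], [vroot_gt_formula]). Such
  formulas define open sets, which gives the continuity; the conjunction of
  their negations defines the graph. *)

(** * Signs of real polynomials on intervals *)

Section Crossing.
Local Open Scope classical_set_scope.
Local Open Scope ring_scope.
Set Implicit Arguments.
Unset Strict Implicit.
Unset Printing Implicit Defensive.
Context {R : realType}.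
Implicit Types (a b c x y z : R) (p q P Q : {poly R}).

Lemma horner_ge0_closure a b p : a < b ->
  (forall x, a < x < b -> 0 <= p.[x]) -> forall x, a <= x <= b -> 0 <= p.[x].
Proof.
move=> ab p_ge0 x /andP[ax xb]; rewrite leNgt; apply/negP => px_lt0.
have [e e_gt0 pe] := @poly_cont _ x p (- p.[x]) ltac:(by rewrite oppr_gt0).
(* moving from x towards the midpoint by a proportion t < 1 gives a point of
   ]a, b[ at distance at most t (b - a) < e from x *)
pose t := e / (e + (b - a)).
have den_gt0 : 0 < e + (b - a) by lra.
have t_gt0 : 0 < t by rewrite divr_gt0.
have t_lt1 : t < 1 by rewrite ltr_pdivrMr//; lra.
have te : t * (e + (b - a)) = e by rewrite divfK// gt_eqF.
pose y := x + t * ((a + b) / 2 - x).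
have /p_ge0 py : a < y < b by rewrite /y; apply/andP; split; nra.
have /pe : `|y - x| < e by rewrite ltr_norml /y; apply/andP; split; nra.
by rewrite ltr_norml; lra.
Qed.

(** Monotonicity is strict although the derivative may vanish at some points,
because a polynomial which takes the same value infinitely often is constant. *)
Lemma ltr_horner_deriv_ge0 a b p : (1 < size p)%N ->
  (forall x, a < x < b -> 0 <= p^`().[x]) ->
  {in `[a, b] &, {homo horner p : x y / x < y}}.
Proof.
move=> p_size p'_ge0 x y xab yab xy.
have mono : {in `[a, b] &, {homo horner p : x y / x <= y}}.
  by apply: ler_hornerW => u; rewrite in_itv/=; exact: p'_ge0.
rewrite lt_neqAle mono// ?ltW// andbT; apply/negP => /eqP pxy.
move: xab yab; rewrite !in_itv/= => xab yab.
have p_cst u : x <= u <= y -> p.[u] = p.[x].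
  move=> xuy; apply/eqP; rewrite eq_le {1}pxy.
  by rewrite !mono ?in_itv//=; lra.
(* infinitely many distinct points of [x, y] *)
pose u (i : nat) := x + (y - x) / i.+1%:R.
have u_inj : injective u.
  have yx0 : y - x != 0 by rewrite subr_eq0 gt_eqF.
  move=> i j /addrI /(mulfI yx0) /invr_inj.
  by move=> /eqP; rewrite eqr_nat eqSS => /eqP.
pose q := p - p.[x]%:P.
have q_size : size q = size p.
  by rewrite size_polyDl// size_polyN (leq_ltn_trans (size_polyC_leq1 _)).
have q0 : q = 0.
  apply: (@poly_ltsp_roots _ _ [seq u i | i <- iota 0 (size p)]).
  - by rewrite size_map size_iota q_size.
  - by rewrite map_inj_uniq// iota_uniq.
  apply/allP => _ /mapP[i _ ->]; rewrite rootE !hornerE p_cst ?subrr//.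
  have i1 : 1 <= i.+1%:R :> R by rewrite ler1n.
  have i_gt0 : 0 < i.+1%:R :> R by lra.
  have : 0 <= (y - x) / i.+1%:R <= y - x.
    by rewrite divr_ge0 ?ler_pdivrMr//=; nra.
  by rewrite /u; move: (_ / _) => w; lra.
by rewrite -q_size q0 size_poly0 in p_size.
Qed.

(** * Crossing points *)

(** For [p] increasing from [lo] to [hi], the place where [p] changes sign, or
the end towards which |p| decreases when [p] keeps a constant sign. Only the
signs of [p] at the other points of the interval are mentioned, so that for
[lo = hi] the crossing is their common value whatever [p] is. *)
Record crossing (lo hi : \bar R) p z : Prop := Crossing {
  crossing_ge : (lo <= z%:E)%E;
  crossing_le : (z%:E <= hi)%E;
  crossing_lt0 : forall c, (lo <= c%:E)%E -> c < z -> p.[c] < 0;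
  crossing_gt0 : forall c, (c%:E <= hi)%E -> z < c -> 0 < p.[c] }.

Lemma crossing_unique lo hi p z w :
  crossing lo hi p z -> crossing lo hi p w -> z = w.
Proof.
wlog zw : z w / z < w => [hw cz cw|cz cw].
  by case: (ltgtP z w) => // ?; [exact: hw|exact/esym/hw].
pose c := (z + w) / 2; have [zc cw'] : z < c /\ c < w by rewrite /c; lra.
have := crossing_gt0 cz (le_trans _ (crossing_le cw)) zc.
have := crossing_lt0 cw (le_trans (crossing_ge cz) _) cw'.
rewrite !lee_fin => /(_ (ltW zc)) h1 /(_ (ltW cw')) h2; lra.
Qed.

(** By continuity, from the signs at the left of [z]. *)
Lemma crossing_le0 lo hi p z : crossing lo hi p z ->
  (lo < z%:E)%E -> p.[z] <= 0.
Proof.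
move=> cz loz.
have [a az loa] : exists2 a, a < z & (lo <= a%:E)%E.
  case: lo loz {cz} => [a| |]//.
    by rewrite lte_fin => az; exists a.
  by move=> _; exists (z - 1); rewrite ?leNye//; lra.
rewrite -oppr_ge0 -hornerN; apply: (horner_ge0_closure az); last by lra.
move=> x /andP[ax xz]; rewrite hornerN oppr_ge0.
by rewrite ltW// (crossing_lt0 cz)// (le_trans loa)// lee_fin ltW.
Qed.

Lemma crossing_ge0 lo hi p z : crossing lo hi p z ->
  (z%:E < hi)%E -> 0 <= p.[z].
Proof.
move=> cz zhi.
have [b zb bhi] : exists2 b, z < b & (b%:E <= hi)%E.
  case: hi zhi {cz} => [b| |]//.
    by rewrite lte_fin => zb; exists b.
  by move=> _; exists (z + 1); rewrite ?leey//; lra.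
apply: (horner_ge0_closure zb); last by lra.
move=> x /andP[zx xb].
by rewrite ltW// (crossing_gt0 cz)// (le_trans _ bhi)// lee_fin ltW.
Qed.

(** The comparison with [c] needs only strict inequalities on the sign of [p] at
[c] and on the ends: this is what makes virtual roots continuous and
semialgebraic. *)
Lemma crossing_ltP lo hi p z c : crossing lo hi p z ->
  z < c <-> (lo < c%:E)%E /\ (0 < p.[c] \/ (hi < c%:E)%E).
Proof.
move=> cz; split=> [zc|[loc [pc|hic]]].
- split; first by rewrite (le_lt_trans (crossing_ge cz)).
  by case: (leP (c%:E) hi) => chi; [left; exact: (crossing_gt0 cz)|right].
- rewrite ltNge le_eqVlt; apply/negP => /predU1P[cE|cltz].
    by move: (crossing_le0 cz); rewrite -cE => /(_ loc); rewrite leNgt pc.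
  by move: (crossing_lt0 cz (ltW loc) cltz); rewrite ltNge ltW.
- by rewrite -lte_fin (le_lt_trans (crossing_le cz)).
Qed.

Lemma crossing_gtP lo hi p z c : crossing lo hi p z ->
  c < z <-> (c%:E < hi)%E /\ (p.[c] < 0 \/ (c%:E < lo)%E).
Proof.
move=> cz; split=> [zc|[loc [pc|hic]]].
- split; first by rewrite (lt_le_trans _ (crossing_le cz)).
  by case: (leP lo (c%:E)) => chi; [left; exact: (crossing_lt0 cz)|right].
- rewrite ltNge le_eqVlt; apply/negP => /predU1P[cE|cltz].
    by move: (crossing_ge0 cz); rewrite cE => /(_ loc); rewrite leNgt pc.
  by move: (crossing_gt0 cz (ltW loc) cltz); rewrite ltNge ltW.
- by rewrite -lte_fin (lt_le_trans _ (crossing_ge cz)).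
Qed.

Lemma crossing_root lo hi p x : crossing lo hi p x ->
  [\/ p.[x] = 0, lo = x%:E | hi = x%:E].
Proof.
move=> cx.
have [->|xlo] := eqVneq lo x%:E; first exact: Or32.
have [->|xhi] := eqVneq hi x%:E; first exact: Or33.
apply: Or31; apply/eqP; rewrite eq_le (crossing_le0 cx) ?(crossing_ge0 cx)//.
  by rewrite lt_neqAle eq_sym xhi (crossing_le cx).
by rewrite lt_neqAle xlo (crossing_ge cx).
Qed.

(** * The minimizer of |P| is a crossing point *)

Lemma absmin_set_neq0 a b P : a <= b ->
  (forall x y, a <= x <= b -> a <= y <= b -> 0 <= P^`().[x] * P^`().[y]) ->
  absmin_set a b P (absmin_fin a b P).
Proof.
move=> ab P'; rewrite /absmin_fin.
have cP : {within `[a, b]%classic, continuous (fun x => `|P.[x]|)}.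
  apply: continuous_subspaceT => x.
  by apply: continuous_comp; [exact: continuous_horner|exact: norm_continuous].
have [z zab zmin] := EVT_min ab cP.
by apply: (@xgetPex _ 0); exists z; split.
Qed.

(** Were [s *: P] nonnegative at some [c] on the left of the minimizer [z], it
would be larger at [z], against the minimality of |P| at [z]; the right-hand
side is symmetric. The sign of the derivative is assumed on the open interval
only, so that nothing is required when [a = b]. *)
Lemma absmin_fin_crossing a b P k (s := (-1) ^+ k : R) : a <= b ->
  (1 < size P)%N ->
  (forall x, a < x < b -> 0 <= s * P^`().[x]) ->
  crossing a%:E b%:E (s *: P) (absmin_fin a b P).
Proof.
move=> ab P_size P'oo.
have s2 : s * s = 1 by rewrite -expr2 sqrr_sign.
have s0 : s != 0 by rewrite signr_eq0.
have P'cc x : a < b -> a <= x <= b -> 0 <= s * P^`().[x].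
  move=> ab'; rewrite -hornerZ; apply: horner_ge0_closure => // u.
  by rewrite hornerZ; exact: P'oo.
have [|_ _ zab zmin] := @absmin_set_neq0 a b P ab.
  move=> x y xab yab; have [abE|ab'] := eqVneq a b.
    have -> : x = y by lra.
    by rewrite -expr2 sqr_ge0.
  have {}ab' : a < b by rewrite lt_neqAle ab'.
  (* the two factors s cancel, so this is a product of nonnegative numbers *)
  have -> : P^`().[x] * P^`().[y] = (s * P^`().[x]) * (s * P^`().[y]).
    by rewrite mulrACA s2 mul1r.
  by rewrite mulr_ge0// P'cc.
set z := absmin_fin a b P in zab zmin *.
have absE u : `|(s *: P).[u]| = `|P.[u]|.
  by rewrite hornerZ normrM normrX normrN1 expr1n mul1r.
have mono : {in `[a, b] &, {homo horner (s *: P) : x y / x < y}}.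
  apply: ltr_horner_deriv_ge0; first by rewrite size_scale.
  by move=> x xab; rewrite derivZ hornerZ P'oo.
have [az zb] := andP zab.
split; rewrite ?lee_fin// => c; rewrite lee_fin => hc hz.
- have pcz : (s *: P).[c] < (s *: P).[z].
    by apply: mono; rewrite ?in_itv//=; lra.
  rewrite ltNge; apply/negP => pc.
  have := zmin c; rewrite -!absE !ger0_norm//; last by lra.
  by move=> /(_ ltac:(lra)); lra.
- have pcz : (s *: P).[z] < (s *: P).[c].
    by apply: mono; rewrite ?in_itv//=; lra.
  rewrite ltNge; apply/negP => pc.
  have := zmin c; rewrite -!absE !ler0_norm//; last by lra.
  by move=> /(_ ltac:(lra)); lra.
Qed.

Lemma crossing_pinfty a b p z : crossing a%:E b%:E p z ->
  (forall c, b <= c -> 0 < p.[c]) -> crossing a%:E +oo%E p z.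
Proof.
move=> cz pb; split; rewrite ?leey ?(crossing_ge cz)//.
  by move=> c; exact: (crossing_lt0 cz).
move=> c _ zc; have [bc|cb] := leP b c; first exact: pb.
by apply: (crossing_gt0 cz) => //; rewrite lee_fin ltW.
Qed.

Lemma crossing_minfty a b p z : crossing a%:E b%:E p z ->
  (forall c, c <= a -> p.[c] < 0) -> crossing -oo%E b%:E p z.
Proof.
move=> cz pa; split; rewrite ?leNye ?(crossing_le cz)//.
  move=> c _ zc; have [ca|ac] := leP c a; first exact: pa.
  by apply: (crossing_lt0 cz) => //; rewrite lee_fin ltW.
by move=> c; exact: (crossing_gt0 cz).
Qed.

Lemma root_bound_gt0 d P : 0 < root_bound d P.
Proof.
by rewrite /root_bound ltr_pwDl// bigmax_ge_id.
Qed.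

(** Cauchy's bound: if M bounds the |P`_i| and |x| >= 1 + M, the lower terms are
at most M (1 + |x| + ... + |x|^(d-1)), hence at most
(|x| - 1) (1 + |x| + ... + |x|^(d-1)) = |x|^d - 1. *)
Lemma lower_terms_lt d P x : root_bound d P <= `|x| ->
  `|\sum_(i < d) P`_i * x ^+ i| < `|x| ^+ d.
Proof.
rewrite /root_bound; set M := \big[_/_]_(i < d) _ => Mx.
have M_ge0 : 0 <= M by exact: bigmax_ge_id.
set t := `|x| in Mx *.
have le_geom : `|\sum_(i < d) P`_i * x ^+ i| <= M * \sum_(i < d) t ^+ i.
  rewrite mulr_sumr; apply: (le_trans (ler_norm_sum _ _ _)).
  apply: ler_sum => i _; rewrite normrM normrX ler_wpM2r ?exprn_ge0//.
  exact: (le_bigmax 0 (fun i : 'I_d => `|P`_i|)).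
apply: (le_lt_trans le_geom).
have S_ge0 : 0 <= \sum_(i < d) t ^+ i.
  by apply: sumr_ge0 => i _; exact: exprn_ge0 (normr_ge0 x).
have := subrX1 t d; move: (t ^+ d) (\sum_(i < d) _) S_ge0 => T S S_ge0 TE.
by nra.
Qed.

Lemma horner_monic d P x : P \is monic -> size P = d.+1 ->
  P.[x] = \sum_(i < d) P`_i * x ^+ i + x ^+ d.
Proof.
move=> /monicP; rewrite lead_coefE => Pm Ps.
by rewrite horner_coef Ps big_ord_recr/= -[X in P`_X]/(d.+1.-1) -Ps Pm mul1r.
Qed.

Lemma horner_gt0_root_bound d P x : P \is monic -> size P = d.+1 ->
  root_bound d P <= x -> 0 < P.[x].
Proof.
move=> Pm Ps mx; have x_gt0 := lt_le_trans (root_bound_gt0 d P) mx.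
have := @lower_terms_lt d P x; rewrite (horner_monic _ Pm Ps) (gtr0_norm x_gt0).
by move=> /(_ mx); rewrite ltr_norml; lra.
Qed.

Lemma horner_sign_root_bound d P x : P \is monic -> size P = d.+1 ->
  x <= - root_bound d P -> 0 < (-1) ^+ d * P.[x].
Proof.
move=> Pm Ps xm; have m_gt0 := root_bound_gt0 d P.
have xN : `|x| = - x by rewrite ltr0_norm//; lra.
have := @lower_terms_lt d P x; rewrite (horner_monic _ Pm Ps) xN.
move=> /(_ ltac:(lra)); set S := \sum_(i < d) _.
rewrite mulrDr -exprMn mulN1r.
have -> : `|S| = `|(-1) ^+ d * S| by rewrite normrM normrX normrN1 expr1n mul1r.
by rewrite ltr_norml; lra.
Qed.

(** Truncating the half-line at [root_bound] does not change the crossing point,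
as [P] is positive beyond it. *)
Lemma absmin_pinfty_crossing d a P : P \is monic -> size P = d.+2 ->
  (forall x, a < x -> 0 <= P^`().[x]) ->
  crossing a%:E +oo%E P (absmin d.+1 a%:E +oo%E P).
Proof.
move=> Pm Ps P'oo; rewrite /absmin.
have -> : `[< forall x, a <= x -> 0 <= P^`().[x] >] = true.
  apply/asboolP => x ax; apply: (@horner_ge0_closure a (x + 1)).
  - by lra.
  - by move=> u /andP[au _]; exact: P'oo.
  - by lra.
set b := Num.max _ _.
have ab : a <= b by rewrite le_max lexx.
apply: (@crossing_pinfty _ b).
  rewrite -[X in crossing _ _ X _](scale1r P).
  apply: (@absmin_fin_crossing _ _ _ 0%N ab).
    by rewrite Ps.
  by move=> x /andP[ax _]; rewrite mul1r P'oo.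
by move=> c; rewrite ge_max => /andP[_]; exact: horner_gt0_root_bound.
Qed.

Lemma absmin_minfty_crossing d b P : P \is monic -> size P = d.+2 ->
  (forall x, x < b -> 0 <= (-1) ^+ d * P^`().[x]) ->
  crossing -oo%E b%:E ((-1) ^+ d *: P) (absmin d.+1 -oo%E b%:E P).
Proof.
move=> Pm Ps P'oo; rewrite /absmin.
have -> : `[< forall x, x <= b -> 0 <= (-1) ^+ d.+1.-1 * P^`().[x] >] = true.
  apply/asboolP => x xb; rewrite -hornerZ.
  apply: (@horner_ge0_closure (x - 1) b).
  - by lra.
  - by move=> u /andP[_ ub]; rewrite hornerZ; exact: P'oo.
  - by lra.
set a := Num.min _ _.
have ab : a <= b by rewrite ge_min lexx.
apply: (@crossing_minfty a).
  apply: absmin_fin_crossing => //; first by rewrite Ps.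
  by move=> x /andP[_ xb]; rewrite P'oo.
move=> c; rewrite le_min => /andP[_ cm].
have := horner_sign_root_bound Pm Ps cm.
by rewrite hornerZ exprS mulN1r mulNr oppr_gt0.
Qed.

(** * Virtual roots are crossing points *)

Lemma vroot0 d P : vroot d 0%N%:Z P = -oo%E.
Proof. by case: d. Qed.

Lemma vroot_gt d j P : (d < j)%N -> vroot d j%:Z P = +oo%E.
Proof.
move=> dj; have j_gt0 : (0 < j)%N by apply: leq_ltn_trans dj.
by case: d dj => [|d] dj /=; rewrite lez_nat leqNgt j_gt0/= ?ltz_nat ?dj.
Qed.

Lemma vroot1 P : vroot 1 1%N%:Z P = (- P`_0)%:E.
Proof. by []. Qed.

Lemma vrootS d j P (Q := d.+2%:R^-1 *: P^`()) : (j <= d.+1)%N ->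
  vroot d.+2 j.+1%:Z P =
  (absmin d.+2 (vroot d.+1 j%:Z Q) (vroot d.+1 j.+1%:Z Q) P)%:E.
Proof.
move=> jd; have jE : j.+1%:Z - 1 = j%:Z by lia.
transitivity (if d.+2%:Z < j.+1%:Z then +oo%E else
  (absmin d.+2 (vroot d.+1 (j.+1%:Z - 1) Q) (vroot d.+1 j.+1%:Z Q) P)%:E) => //.
by rewrite jE ltz_nat ltnS ltnNge jd.
Qed.

Lemma vroot_finE d j P : (0 < j <= d)%N ->
  vroot d j%:Z P = (fine (vroot d j%:Z P))%:E.
Proof.
case: j => // j /andP[_]; case: d => [|[|d]]//; last first.
  by move=> jd; rewrite vrootS.
by case: j.
Qed.

End Crossing.

(** The ring [A] is the field of real numbers, or the ring of rational
polynomials in the coefficients, where [d.+1] is also invertible. *)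
Lemma monic_deriv_normalized (A : nzRingType) (u : A) (d : nat) (P : {poly A}) :
  P \is monic -> size P = d.+2 -> u * d.+1%:R = 1 ->
  (u *: P^`() \is monic) * (size (u *: P^`()) = d.+1).
Proof.
move=> /monicP; rewrite lead_coefE => Pm Ps ud; rewrite Ps/= in Pm.
have cd : (u *: P^`())`_d = 1 by rewrite coefZ coef_deriv Pm.
have sd : size (u *: P^`()) = d.+1.
  apply/eqP; rewrite eqn_leq; apply/andP; split.
    apply: (leq_trans (size_scale_leq _ _)).
    by rewrite -ltnS -Ps lt_size_deriv// -size_poly_gt0 Ps.
  rewrite ltnNge; apply/negP => /leq_sizeP/(_ d (leqnn d)).
  by rewrite cd => /eqP; rewrite oner_eq0.
by split=> //; apply/monicP; rewrite lead_coefE sd cd.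
Qed.

Section VirtualRoots.
Set Implicit Arguments.
Unset Strict Implicit.
Unset Printing Implicit Defensive.
Local Open Scope classical_set_scope.
Local Open Scope ring_scope.
Context {R : realType}.
Implicit Types (a b c x y z : R) (p q P Q : {poly R}).

Lemma monic_nderiv d P (Q := d.+1%:R^-1 *: P^`()) :
  P \is monic -> size P = d.+2 ->
  (Q \is monic) * (size Q = d.+1).
Proof.
by move=> Pm Ps; apply: monic_deriv_normalized => //; rewrite mulVf// pnatr_eq0.
Qed.

(** The intervals are open: between two equal virtual roots the sign of [P] can
be the opposite one, as for x^2 + 1, whose two virtual roots are 0. *)
Definition vroot_signs d P := forall j, (j <= d)%N ->
  (vroot d j%:Z P <= vroot d j.+1%:Z P)%E /\
  forall x, (vroot d j%:Z P < x%:E < vroot d j.+1%:Z P)%E ->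
    0 < (-1) ^+ (d - j) * P.[x].

(** The sign of [Q] between two consecutive virtual roots is that of the
derivative of [P], so [absmin] is applied inside its domain of definition. *)
Lemma vroot_crossing_step d j P (Q := d.+1%:R^-1 *: P^`()) :
  P \is monic -> size P = d.+2 -> (j <= d)%N -> vroot_signs d Q ->
  exists2 z, vroot d.+1 j.+1%:Z P = z%:E &
    crossing (vroot d j%:Z Q) (vroot d j.+1%:Z Q) ((-1) ^+ (d - j) *: P) z.
Proof.
move=> Pm Ps jd Qsigns.
case: d => [|d] in Q Ps jd Qsigns *.
  move: jd; rewrite leqn0 => /eqP->; rewrite vroot1 vroot0 vroot_gt//.
  have PE x : P.[x] = P`_0 + x.
    by rewrite (horner_monic _ Pm Ps) big_ord1 expr0 mulr1 expr1.
  exists (- P`_0) => //; rewrite subnn scale1r.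
  split; rewrite ?leNye ?leey// => c _; rewrite PE; lra.
rewrite vrootS//; eexists; first by [].
have P'E x : P^`().[x] = d.+2%:R * Q.[x].
  by rewrite /Q hornerZ mulrA divff ?mul1r// pnatr_eq0.
have P'sign x : (vroot d.+1 j%:Z Q < x%:E < vroot d.+1 j.+1%:Z Q)%E ->
    0 <= (-1) ^+ (d.+1 - j) * P^`().[x].
  by move=> /(Qsigns j jd).2; rewrite P'E mulrCA => /ltW; apply: mulr_ge0.
have le_jj1 := (Qsigns j jd).1.
rewrite -/Q; case: j jd P'sign le_jj1 => [|j] jd.
  rewrite vroot0 subn0 (@vroot_finE _ _ 1)//; move: (fine _) => b P'sign _.
  apply: absmin_minfty_crossing => // x xb.
  by apply: P'sign; rewrite ltNyr lte_fin.
rewrite (@vroot_finE _ d.+1 j.+1)//; move: (fine _) => a.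
move: jd; rewrite leq_eqVlt => /predU1P[[->]|jd].
  rewrite vroot_gt// subnn scale1r => P'sign _.
  apply: absmin_pinfty_crossing => // x xb.
  by rewrite -[X in 0 <= X]mul1r P'sign// lte_fin xb ltry.
rewrite (@vroot_finE _ d.+1 j.+2)//; move: (fine _) => b P'sign.
by rewrite lee_fin => ab; apply: absmin_fin_crossing; rewrite ?Ps.
Qed.

(** Two consecutive virtual roots z <= w of [P] are the crossings of
(-1)^(d-j) P on the left and of its opposite on the right of a virtual root m of
the derivative; both conditions give the same sign to [P] on ]z, m] and
[m, w[. *)
Lemma vroot_signsP d P : P \is monic -> size P = d.+1 -> vroot_signs d P.
Proof.
elim: d P => [|d IHd] P Pm Ps.
  move=> j; rewrite leqn0 => /eqP->; rewrite vroot0 leNye; split=> // x _.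
  by rewrite (horner_monic _ Pm Ps) big_ord0 add0r expr0 mulr1.
have [Qm Qs] := monic_nderiv Pm Ps.
have cr j jd := vroot_crossing_step Pm Ps jd (IHd _ Qm Qs) (j := j).
case=> [_|j].
  rewrite vroot0 leNye; split=> // x /andP[_].
  have [z -> cz] := cr 0%N isT; rewrite lte_fin => xz.
  have := crossing_lt0 cz (c := x); rewrite vroot0 leNye => /(_ isT xz).
  by rewrite hornerZ subn0 exprS mulN1r mulNr oppr_gt0.
rewrite ltnS => jd; have [z -> cz] := cr j jd; rewrite subSS.
move: jd; rewrite leq_eqVlt => /predU1P[jd|jd].
  subst j.
  rewrite vroot_gt// leey; split=> // x /andP[]; rewrite lte_fin => zx _.
  have := crossing_gt0 cz (c := x); rewrite vroot_gt// leey => /(_ isT zx).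
  by rewrite hornerZ.
have [w -> cw] := cr j.+1 jd.
split; first by rewrite (le_trans (crossing_le cz)) ?(crossing_ge cw).
move=> x; rewrite !lte_fin => /andP[zx xw].
set m := vroot d j.+1%:Z _ in cz cw.
have [xm|mx] := leP x%:E m.
  by have := crossing_gt0 cz xm zx; rewrite hornerZ.
have := crossing_lt0 cw (ltW mx) xw; rewrite hornerZ.
by rewrite -[(d - j)%N](subnSK jd) exprS mulN1r mulNr oppr_gt0.
Qed.

Lemma vroot_crossing d j P (Q := d.+1%:R^-1 *: P^`()) :
  P \is monic -> size P = d.+2 -> (j <= d)%N ->
  exists2 z, vroot d.+1 j.+1%:Z P = z%:E &
    crossing (vroot d j%:Z Q) (vroot d j.+1%:Z Q) ((-1) ^+ (d - j) *: P) z.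
Proof.
move=> Pm Ps jd; apply: vroot_crossing_step => //.
by have [Qm Qs] := monic_nderiv Pm Ps; exact: vroot_signsP.
Qed.

(** * Real roots, and zeros of P* *)

(** The index [j] is the least one such that [x] is at most the (j+1)-st virtual
root of the derivative, so that [x] lies between the j-th and the (j+1)-st. *)
Lemma vroot_root d P x : P \is monic -> size P = d.+2 -> root P x ->
  exists2 j, (j <= d)%N & vroot d.+1 j.+1%:Z P = x%:E.
Proof.
move=> Pm Ps /rootP Px0.
have [Qm Qs] := monic_nderiv Pm Ps; set Q := _ *: _ in Qm Qs.
have ex_hi : exists j, (x%:E <= vroot d j.+1%:Z Q)%E.
  by exists d; rewrite vroot_gt// leey.
case: (ex_minnP ex_hi) => j xhi j_min.
have jd : (j <= d)%N by apply: j_min; rewrite vroot_gt// leey.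
have lox : (vroot d j%:Z Q <= x%:E)%E.
  case: j {xhi jd} j_min => [|j] j_min; first by rewrite vroot0 leNye.
  rewrite leNgt; apply/negP => /ltW /j_min.
  by rewrite ltnn.
exists j => //; have [z -> cz] := vroot_crossing Pm Ps jd; rewrite -/Q in cz.
congr (_%:E); apply: (crossing_unique cz).
set s := (-1) ^+ _ in cz *.
have mono u v : (vroot d j%:Z Q <= u%:E)%E -> (v%:E <= vroot d j.+1%:Z Q)%E ->
    u < v -> (s *: P).[u] < (s *: P).[v].
  move=> lou vhi uv.
  apply: (@ltr_horner_deriv_ge0 _ u v); rewrite ?in_itv/= ?lexx ?ltW//.
    by rewrite size_scale ?signr_eq0 ?Ps.
  move=> y /andP[uy yv].
  have P'E : P^`().[y] = d.+1%:R * Q.[y].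
    by rewrite /Q hornerZ mulVKf// pnatr_eq0.
  rewrite derivZ hornerZ P'E mulrCA mulr_ge0// ltW//.
  apply: (vroot_signsP Qm Qs jd).2.
  by rewrite (le_lt_trans lou) ?lte_fin// (lt_le_trans _ vhi) ?lte_fin.
have sPx : (s *: P).[x] = 0 by rewrite hornerZ Px0 mulr0.
by split=> // c ? ?; rewrite -sPx; apply: mono.
Qed.

Lemma pstarS d P (Q := d.+1%:R^-1 *: P^`()) : P \is monic -> size P = d.+2 ->
  pstar d.+1 P = pstar d Q * P.
Proof.
move=> Pm Ps; rewrite /pstar big_ord_recr/=; congr (_ * _); last first.
  by rewrite /normalized_deriv subnn derivn0 (monicP Pm) invr1 scale1r.
apply: eq_bigr => i _; rewrite /normalized_deriv (@subSn i d); last first.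
  by rewrite -ltnS.
rewrite derivSn /Q derivnZ lead_coefZ invfM invrK scalerA.
by rewrite mulrAC mulfV ?mul1r// pnatr_eq0.
Qed.

Lemma pstar_vroot d j P : P \is monic -> size P = d.+1 -> (0 < j <= d)%N ->
  (pstar d P).[fine (vroot d j%:Z P)] = 0.
Proof.
elim: d j P => [|d IHd] [|j] P Pm Ps // jd; rewrite pstarS// hornerM.
have [Qm Qs] := monic_nderiv Pm Ps.
have [z -> cz] := vroot_crossing Pm Ps jd => /=.
case: (crossing_root cz) => [|loz|hiz].
- rewrite hornerZ => /eqP; rewrite mulf_eq0 signr_eq0 => /eqP->.
  by rewrite mulr0.
- have j_gt0 : (0 < j)%N by case: (j) loz => //; rewrite vroot0.
  by have := IHd j _ Qm Qs; rewrite loz /= j_gt0 => ->; rewrite ?mul0r.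
- have jd' : (j.+1 <= d)%N.
    by rewrite leqNgt; apply/negP => ?; move: hiz; rewrite vroot_gt.
  by have := IHd j.+1 _ Qm Qs; rewrite hiz /= jd' => ->; rewrite ?mul0r.
Qed.

End VirtualRoots.

(** * Integral equations and formulas over Q *)

Lemma monic_sub_lower (A : nzRingType) (d : nat) (c : 'I_d -> A) :
  ('X^d - \sum_(i < d) c i *: 'X^i \is monic) *
  (size ('X^d - \sum_(i < d) c i *: 'X^i) = d.+1).
Proof.
have lt_lower : (size (- \sum_(i < d) c i *: 'X^i) < size ('X^d : {poly A}))%N.
  rewrite size_polyN size_polyXn ltnS; apply: (leq_trans (size_sum _ _ _)).
  apply/bigmax_leqP => i _.
  by rewrite (leq_trans (size_scale_leq _ _))// size_polyXn.
split; last by rewrite size_polyDl// size_polyXn.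
by rewrite monicE lead_coefDl// lead_coefXn.
Qed.

Local Notation Qpoly n := (mpoly.mpoly n rat).

HB.instance Definition _ (R : realType) (n : nat) (v : 'rV[R]_n) :=
  GRing.RMorphism.copy (evalQ v)
    (meval (fun i => v ord0 i) \o map_mpoly (ratr : rat -> R)).

Section IntegralContinuous.
Set Implicit Arguments.
Unset Strict Implicit.
Unset Printing Implicit Defensive.
Local Open Scope classical_set_scope.
Local Open Scope ring_scope.
Context {R : realType}.

Lemma evalQC n (v : 'rV[R]_n) (q : rat) : evalQ v (mpolyC n q) = ratr q.
Proof. by rewrite /evalQ map_mpolyC mevalC. Qed.

Definition Qvar n (i : 'I_n) : Qpoly n := mpolyX _ (mnm1 i).

Lemma evalQ_var n (v : 'rV[R]_n) (i : 'I_n) : evalQ v (Qvar i) = v ord0 i.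
Proof. by rewrite /evalQ map_mpolyX mevalXU. Qed.

Local Notation evQ v := (map_poly (evalQ v)).

Definition Qnderiv n (d : nat) (G : {poly Qpoly n}) : {poly Qpoly n} :=
  mpolyC n d.+1%:R^-1 *: G^`().

Lemma evQ_nderiv n d (v : 'rV[R]_n) (G : {poly Qpoly n}) :
  evQ v (Qnderiv d G) = d.+1%:R^-1 *: (evQ v G)^`().
Proof.
by rewrite /Qnderiv map_polyZ/= evalQC fmorphV/= ratr_nat deriv_map.
Qed.

(** The polynomial [pstar] of a generic polynomial, built from the recursion
[pstarS]; it is monic because each normalized derivative is. *)
Lemma pstar_integral d n (G : {poly Qpoly n}) : G \is monic -> size G = d.+1 ->
  exists2 q : {poly Qpoly n}, q \is monic &
    forall v : 'rV[R]_n, evQ v q = pstar d (evQ v G).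
Proof.
elim: d G => [|d IHd] G Gm Gs.
  exists 1; first exact: monic1.
  move=> v; rewrite rmorph1 /pstar big_ord1 /normalized_deriv derivn0.
  have -> : G = 1.
    by move: Gm; rewrite monicE (size1_polyC (eq_leq Gs)) lead_coefC => /eqP->.
  by rewrite rmorph1 lead_coef1 invr1 scale1r.
have [Hm Hs] : (Qnderiv d G \is monic) * (size (Qnderiv d G) = d.+1).
  apply: monic_deriv_normalized => //.
  have -> : d.+1%:R = mpolyC n d.+1%:R :> Qpoly n by rewrite rmorph_nat.
  by rewrite -rmorphM mulVf ?rmorph1// pnatr_eq0.
have [q qm qE] := IHd _ Hm Hs.
exists (q * G); first by rewrite monicMl.
move=> v; rewrite rmorphM/= qE evQ_nderiv -pstarS//; first exact: monic_map.
by rewrite size_map_poly_id0// (monicP Gm) rmorph1 oner_eq0.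
Qed.

(** Formulas built from strict inequalities without negation; they define open
sets. *)
Fixpoint Qpositive n (phi : Qformula n) : bool :=
  match phi with
  | QPos _ => true
  | QAnd f g | QOr f g => Qpositive f && Qpositive g
  | _ => false
  end.

(** The formula is obtained by iterating [crossing_ltP] down the degrees. It is
stated for a family [G] of polynomials and a point [c] both depending
polynomially on the parameters, since the recursion replaces [G] by its
normalized derivative. *)
Lemma vroot_lt_formula n (c : Qpoly n) d j (G : {poly Qpoly n}) :
  exists2 phi : Qformula n, Qpositive phi &
    forall w : 'rV[R]_n, evQ w G \is monic -> size (evQ w G) = d.+1 ->
      Qholds w phi <-> (vroot d j%:Z (evQ w G) < (evalQ w c)%:E)%E.
Proof.
elim: d j G => [|d IHd] j G.
  case: j => [|j].
    exists (QPos 1) => // w _ _; rewrite vroot0/= rmorph1.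
    by split=> _; rewrite ?ltNyr ?ltr01.
  exists (QPos 0) => // w _ _; rewrite vroot_gt//= rmorph0 ltxx.
  by split=> //; rewrite ltNge leey.
case: j => [|j].
  exists (QPos 1) => // w _ _; rewrite vroot0/= rmorph1.
  by split=> _; rewrite ?ltNyr ?ltr01.
have [jd|dj] := leqP j d; last first.
  exists (QPos 0) => // w _ _; rewrite vroot_gt//= rmorph0 ltxx.
  by split=> //; rewrite ltNge leey.
have [lo lo_pos loP] := IHd j (Qnderiv d G).
have [hi hi_pos hiP] := IHd j.+1 (Qnderiv d G).
exists (QAnd lo (QOr (QPos ((-1) ^+ (d - j) * G.[c])) hi)).
  by rewrite /= lo_pos.
move=> w Gm Gs; have [Qm Qs] := monic_nderiv Gm Gs.
rewrite -evQ_nderiv in Qm Qs.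
have [z -> cz] := vroot_crossing Gm Gs jd.
rewrite lte_fin (crossing_ltP (evalQ w c) cz) -evQ_nderiv /=.
rewrite (loP w Qm Qs) (hiP w Qm Qs).
by rewrite hornerZ horner_map rmorphM rmorphXn rmorphN1.
Qed.

Lemma vroot_gt_formula n (c : Qpoly n) d j (G : {poly Qpoly n}) :
  exists2 phi : Qformula n, Qpositive phi &
    forall w : 'rV[R]_n, evQ w G \is monic -> size (evQ w G) = d.+1 ->
      Qholds w phi <-> ((evalQ w c)%:E < vroot d j%:Z (evQ w G))%E.
Proof.
elim: d j G => [|d IHd] j G.
  case: j => [|j].
    exists (QPos 0) => // w _ _; rewrite vroot0/= rmorph0 ltxx.
    by split=> //; rewrite ltNge leNye.
  exists (QPos 1) => // w _ _; rewrite vroot_gt//= rmorph1.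
  by split=> _; rewrite ?ltry ?ltr01.
case: j => [|j].
  exists (QPos 0) => // w _ _; rewrite vroot0/= rmorph0 ltxx.
  by split=> //; rewrite ltNge leNye.
have [jd|dj] := leqP j d; last first.
  exists (QPos 1) => // w _ _; rewrite vroot_gt//= rmorph1.
  by split=> _; rewrite ?ltry ?ltr01.
have [lo lo_pos loP] := IHd j (Qnderiv d G).
have [hi hi_pos hiP] := IHd j.+1 (Qnderiv d G).
exists (QAnd hi (QOr (QPos (- ((-1) ^+ (d - j) * G.[c]))) lo)).
  by rewrite /= hi_pos.
move=> w Gm Gs; have [Qm Qs] := monic_nderiv Gm Gs.
rewrite -evQ_nderiv in Qm Qs.
have [z -> cz] := vroot_crossing Gm Gs jd.
rewrite lte_fin (crossing_gtP (evalQ w c) cz) -evQ_nderiv /=.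
rewrite (loP w Qm Qs) (hiP w Qm Qs).
by rewrite hornerZ horner_map rmorphN rmorphM rmorphXn rmorphN1 oppr_gt0.
Qed.

Lemma continuous_evalQ (T : topologicalType) n (w : T -> 'rV[R]_n)
    (p : Qpoly n) :
  (forall i, continuous (fun t => w t ord0 i)) ->
  continuous (fun t => evalQ (w t) p).
Proof.
move=> wc; rewrite /evalQ; under eq_fun do rewrite mevalE.
apply: continuous_big => [|m _]; first exact: add_continuous.
move=> t; apply: cvgM; first exact: cvg_cst.
move: t; apply: continuous_big => [|i _]; first exact: mul_continuous.
move=> t; apply: (@continuous_comp _ _ _ (fun t => w t ord0 i)
  (fun x => x ^+ m i)).
  exact: wc.
exact: exprn_continuous.
Qed.

Lemma open_Qpositive (T : topologicalType) n (w : T -> 'rV[R]_n)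
    (phi : Qformula n) :
  (forall i, continuous (fun t => w t ord0 i)) -> Qpositive phi ->
  open [set t | Qholds (w t) phi].
Proof.
move=> wc; elim: phi => //= [p _|f IHf g IHg|f IHf g IHg].
- apply: (@open_comp _ _ (fun t => evalQ (w t) p) [set x | 0 < x]); last first.
    exact: open_gt.
  by move=> t _; exact: continuous_evalQ.
- by move=> /andP[/IHf of_ /IHg og]; exact: openI.
- by move=> /andP[/IHf of_ /IHg og]; exact: openU.
Qed.

Lemma continuous_open_lt_gt (T : topologicalType) (f : T -> R) :
  (forall c, open [set t | f t < c]) -> (forall c, open [set t | c < f t]) ->
  continuous f.
Proof.
move=> flt fgt t; apply/cvgrPdist_lt => e e_gt0.
have lt_near : nbhs t [set u | f u < f t + e].
  by apply: open_nbhs_nbhs; split; [exact: flt|rewrite /= ltrDl].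
have gt_near : nbhs t [set u | f t - e < f u].
  by apply: open_nbhs_nbhs; split; [exact: fgt|rewrite /= ltrBlDr ltrDl].
apply: filterS2 lt_near gt_near => u /= ? ?.
by rewrite ltr_norml; apply/andP; split; lra.
Qed.

(** * Continuity, semialgebraicity and integrality of virtual roots *)

(** The map [e] tells which variables stand for the coefficients: all of them
for the integral equation, all but the last one for the graph. *)
Definition generic_poly n d (e : 'I_d -> 'I_n) : {poly Qpoly n} :=
  'X^d - \sum_(i < d) Qvar (e (rev_ord i)) *: 'X^i.

Lemma evQ_generic n d (e : 'I_d -> 'I_n) (w : 'rV[R]_n) :
  evQ w (generic_poly e) = monic_of_coefs (\row_i w ord0 (e i)).
Proof.
rewrite /generic_poly /monic_of_coefs rmorphB/= map_polyXn rmorph_sum/=.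
congr (_ - _); apply: eq_bigr => i _.
by rewrite map_polyZ/= map_polyXn evalQ_var mxE.
Qed.

Lemma vroot_integral_continuous d j : (0 < j <= d)%N ->
  integral_continuous_over_Q
    (fun v : 'rV[R]_d => fine (vroot d j%:Z (monic_of_coefs v))).
Proof.
move=> jd; set f := fun v => _.
have fE v : vroot d j%:Z (monic_of_coefs v) = (f v)%:E by exact: vroot_finE.
pose G := generic_poly (@lshift d 1); pose c := Qvar (rshift d (@ord0 0)).
have rowE (v : 'rV[R]_d) (y : R) :
    \row_i (row_mx v y%:M) ord0 (lshift 1 i) = v.
  by apply/rowP => i; rewrite mxE row_mxEl.
have cE (v : 'rV[R]_d) (y : R) : evalQ (row_mx v y%:M) c = y.
  by rewrite evalQ_var row_mxEr mxE.
have [lt lt_pos ltP] := vroot_lt_formula c d j G.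
have [gt gt_pos gtP] := vroot_gt_formula c d j G.
have ltfP (v : 'rV[R]_d) (y : R) : Qholds (row_mx v y%:M) lt <-> f v < y.
  have [m s] := monic_sub_lower (fun i : 'I_d => v ord0 (rev_ord i)).
  have := ltP (row_mx v y%:M); rewrite evQ_generic rowE cE fE lte_fin; exact.
have gtfP (v : 'rV[R]_d) (y : R) : Qholds (row_mx v y%:M) gt <-> y < f v.
  have [m s] := monic_sub_lower (fun i : 'I_d => v ord0 (rev_ord i)).
  have := gtP (row_mx v y%:M); rewrite evQ_generic rowE cE fE lte_fin; exact.
have row_cont (y : R) (i : 'I_(d + 1)) :
    continuous (fun v : 'rV[R]_d => row_mx v y%:M ord0 i).
  case: (split_ordP i) => k ->.
    under eq_fun do rewrite row_mxEl; exact: coord_continuous.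
  under eq_fun do rewrite row_mxEr; exact: cst_continuous.
split.
- apply: continuous_open_lt_gt => y.
    rewrite (_ : [set _ | _] = [set v | Qholds (row_mx v y%:M) lt]).
      exact: open_Qpositive.
    by apply/seteqP; split=> v /=; rewrite ltfP.
  rewrite (_ : [set _ | _] = [set v | Qholds (row_mx v y%:M) gt]).
    exact: open_Qpositive.
  by apply/seteqP; split=> v /=; rewrite gtfP.
- exists (QAnd (QNot lt) (QNot gt)); apply/seteqP; split=> [_ [v _ <-]|w] /=.
    by rewrite ltfP gtfP ltxx; split.
  (* every point of R^(d+1) is of the form (v, y) *)
  have -> : w = row_mx (lsubmx w) (w ord0 (rshift d ord0))%:M.
    rewrite -[LHS]hsubmxK; congr row_mx; apply/matrixP => i k.
    by rewrite !ord1 !mxE.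
  rewrite ltfP gtfP => -[/negP nlt /negP ngt]; exists (lsubmx w) => //.
  by congr (row_mx _ _%:M); apply/eqP; rewrite eq_le !leNgt nlt ngt.
- have [Gm Gs] := monic_sub_lower (fun i : 'I_d => Qvar (rev_ord i)).
  have [q qm qE] := pstar_integral Gm Gs.
  exists q => // v; rewrite qE -/(generic_poly id) evQ_generic.
  have -> : \row_i v ord0 (id i) = v by apply/rowP => i; rewrite mxE.
  have [m s] := monic_sub_lower (fun i : 'I_d => v ord0 (rev_ord i)).
  exact: pstar_vroot.
Qed.

End IntegralContinuous.

Theorem proposition2p2 (R : realType) (d : nat) (d_ge1 : (1 <= d)%N) :
  (forall j : nat, (1 <= j <= d)%N ->
    [/\ (forall v : 'rV[R]_d, vroot d j%:Z (monic_of_coefs v) \is a fin_num),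
        integral_continuous_over_Q
          (fun v : 'rV[R]_d => fine (vroot d j%:Z (monic_of_coefs v))) &
        forall P : {poly R}, P \is monic -> size P = d.+1 ->
          (pstar d P).[fine (vroot d j%:Z P)] = 0]) /\
  (forall P : {poly R}, P \is monic -> size P = d.+1 ->
    forall x : R, root P x ->
      exists2 j : nat, (1 <= j <= d)%N & vroot d j%:Z P = x%:E).
Proof.
split=> [j jd|P Pm Ps x Px0].
  split; first by move=> v; rewrite vroot_finE.
  - exact: vroot_integral_continuous.
  - by move=> P Pm Ps; exact: pstar_vroot.
case: d d_ge1 Ps => // d _ Ps.
by have [j jd <-] := vroot_root Pm Ps Px0; exists j.+1.
Qed.
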